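(* Let $k$ be an integer with $k > 2$. For any finite word $w$, let $N_k(w)$ denote the number of distinct non-empty factors of $w$ of the form $\underbrace{uu\cdots u}_{k\text{ times}}$ (with $u$ a word), let $|w|$ denote the length of $w$, and let $|\mathrm{Alph}(w)|$ denote the number of distinct letters occurring in $w$. Then $$N_k(w) \leq \frac{|w| - |\mathrm{Alph}(w)|}{k-2}.$$
   Context: A word is a finite sequence of letters $w = w_1 w_2\cdots w_n$; its length is $|w|=n$, and $\mathrm{Alph}(w)=\{w_i : 1\le i\le n\}$. A word $u$ is a factor of $w$ if $w = pus$ for some (possibly empty) words $p,s$. *)

(* Defs.v *)
From mathcomp Require Import all_boot all_order all_algebra.

Set Implicit Arguments.
Unset Strict Implicit.
Unset Printing Implicit Defensive.

Section Words.

Variable T : eqType.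
Implicit Types (u v w : seq T) (k : nat).

Definition word_pow u k : seq T := flatten (nseq k u).

Definition factors w : seq (seq T) :=
  undup [seq take j (drop i w) | i <- iota 0 (size w).+1,
                                 j <- iota 0 (size w).+1].

Lemma mem_factors v w : (v \in factors w) = infix v w.
Proof.
rewrite mem_undup; apply/allpairsP/infixP => [[[i j] /= [_ _ ->]]|[p [s ->]]].
  exists (take i w), (drop j (drop i w)).
  by rewrite cat_take_drop cat_take_drop.
exists (size p, size v); rewrite !mem_iota !add0n !ltnS !size_cat /=.
split; first by rewrite leq_addr.
  by rewrite addnCA leq_addr.
by rewrite drop_size_cat // take_size_cat.
Qed.

Lemma factors_uniq w : uniq (factors w).
Proof. exact: undup_uniq. Qed.

(* The base of a power may be searched among the factors of the power itself;
   [is_powerP] shows that this loses nothing. *)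
Definition is_power k v : bool := has (fun u => v == word_pow u k) (factors v).

Lemma is_powerP k v : reflect (exists u, v = word_pow u k) (is_power k v).
Proof.
apply: (iffP hasP) => [[u _ /eqP ->]|[u ->]]; first by exists u.
case: k => [|k].
  by exists [::]; rewrite ?mem_factors ?infix0s.
exists u => //; rewrite mem_factors; exact: prefixW (prefix_prefix _ _).
Qed.

Definition num_powers k w : nat :=
  size [seq v <- factors w | (v != [::]) && is_power k v].

Definition Alph w : seq T := undup w.

End Words.

(* Main.v *)
(* In the Rauzy graph of order n of w, pick for each circuit of length at most n
   the Lyndon word l labelling it. As l is unbordered, the edge starting with l
   lies on no shorter circuit; so all these edges can be deleted, from the
   longest circuit to the shortest, without disconnecting the graph, and the
   number of circuits is at most C(n+1) - C(n) + 1, where C counts the factors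
   by length. Summing over 1 <= n < |w| bounds the number of pairs (n, circuit)
   by |w| - |Alph w|. Conversely, a k-power v = (l')^(k m), with l' the rotation by
   i of a Lyndon word l of length p, makes the circuit of l present at all orders
   n from p to (k m - 1) p, and v is charged with the k - 2 orders
   p + ((m - 1) p + i) (k - 2) + j, j < k - 2. *)
Require Import Defs.
From mathcomp Require Import all_boot all_order all_algebra.
From mathcomp Require Import zify.

Set Implicit Arguments.
Unset Strict Implicit.
Unset Printing Implicit Defensive.

(* A Boolean vertex labelling is determined by its value at [r] and its
   differences along the edges, whence 2 ^ #|V| <= 2 ^ (#|E| + 1). *)
Lemma leq_vertices_edges (A B : eqType) (src tgt : B -> A)
    (V : seq A) (E : seq B) (r : A) :
  uniq V ->
  (forall h : A -> bool, h r = false ->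
     {in E, forall e, h (src e) = h (tgt e)} ->
     {in V, forall v, h v = false}) ->
  size V <= (size E).+1.
Proof.
move=> uV ker.
pose ev (f : (size V).-tuple bool) v := nth false f (index v V).
pose phi f := cons_tuple (ev f r)
  (map_tuple (fun e => ev f (src e) (+) ev f (tgt e)) (in_tuple E)).
have phi_inj : injective phi.
  move=> f g [eqr eqE].
  (* Two labellings with the same image have a sum modulo 2 that vanishes at [r] and is constant
     along edges. *)
  have ker_fg : {in V, forall v, ev f v (+) ev g v = false}.
    apply: (ker (fun v => ev f v (+) ev g v)); first by rewrite eqr addbb.
    move=> e eE; have /eq_in_map/(_ e eE) := eqE.
    by do 4!case: (ev _ _).
  apply/val_inj/(@eq_from_nth _ false); rewrite ?size_tuple // => i ltiV.
  have x0 : A by case: (V) ltiV.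
  have := ker_fg _ (mem_nth x0 ltiV); rewrite /ev index_uniq //.
  by do 2!case: (nth _ _ _).
have := leq_card phi phi_inj.
by rewrite !card_tuple card_bool leq_exp2l.
Qed.

(** * Windows of infinite periodic words *)

Section Windows.

Variables (T : eqType).
Implicit Types (x : nat -> T) (u : seq T).

Definition window x i n := [seq x j | j <- iota i n].

Lemma size_window x i n : size (window x i n) = n.
Proof. by rewrite size_map size_iota. Qed.

Lemma nth_window (x0 : T) x i n j : j < n -> nth x0 (window x i n) j = x (i + j).
Proof. by move=> ltjn; rewrite (nth_map 0) ?size_iota // nth_iota. Qed.

Lemma eq_window x y i i' n :
  window x i n = window y i' n <-> (forall j, j < n -> x (i + j) = y (i' + j)).
Proof.
split=> [eqw j ltjn|eqxy].
  by have := congr1 (nth (x 0) ^~ j) eqw; rewrite !nth_window.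
apply: (@eq_from_nth _ (x 0)); rewrite !size_window // => j ltjn.
by rewrite !nth_window // eqxy.
Qed.

Lemma window_cat x i m n : window x i (m + n) = window x i m ++ window x (i + m) n.
Proof. by rewrite /window iotaD map_cat. Qed.

Lemma infix_window x i m j n : j <= i -> i + m <= j + n ->
  infix (window x i m) (window x j n).
Proof.
move=> leji le; have -> : n = (i - j) + (m + (j + n - i - m)) by lia.
rewrite !window_cat subnKC //; apply/infixP; eexists; eexists; reflexivity.
Qed.

Lemma take_window x i m n : m <= n -> take m (window x i n) = window x i m.
Proof.
by move=> lemn; rewrite -(subnKC lemn) window_cat take_size_cat ?size_window.
Qed.

Lemma periodM x p : (forall i, x (i + p) = x i) -> forall m i, x (i + m * p) = x i.
Proof.
move=> per; elim=> [|m IHm] i; first by rewrite mul0n addn0.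
by rewrite mulSn [p + _]addnC addnA per IHm.
Qed.

Lemma period_mod x p i : (forall i, x (i + p) = x i) -> x (i %% p) = x i.
Proof. by move=> /periodM per; rewrite {2}(divn_eq i p) addnC per. Qed.

Lemma window_pow x p i m : (forall i, x (i + p) = x i) ->
  window x i (m * p) = word_pow (window x i p) m.
Proof.
move=> per; elim: m => [//|m IHm].
rewrite mulSn window_cat /word_pow /= -/(word_pow _ _) -IHm; congr (_ ++ _).
by apply/eq_window => j _; rewrite addnAC per.
Qed.

(** The infinite word [u u u ...]; the default [x0] is returned only if [u] is empty. *)
Definition omega (x0 : T) u : nat -> T := fun j => nth x0 u (j %% size u).

Lemma omega_period (x0 : T) u i : omega x0 u (i + size u) = omega x0 u i.
Proof. by rewrite /omega modnDr. Qed.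

Lemma omega_nth (x0 : T) u i : i < size u -> omega x0 u i = nth x0 u i.
Proof. by move=> lti; rewrite /omega modn_small. Qed.

Lemma window_omega (x0 : T) u : window (omega x0 u) 0 (size u) = u.
Proof.
apply: (@eq_from_nth _ x0); rewrite size_window // => i lti.
by rewrite nth_window // omega_nth.
Qed.

Lemma rot_window (x0 : T) u i : i <= size u ->
  rot i u = window (omega x0 u) i (size u).
Proof.
move=> lei; have eu := window_omega x0 u; rewrite -(subnKC lei) window_cat in eu.
rewrite /rot -{1 2}eu drop_size_cat ?take_size_cat ?size_window //.
rewrite -[in RHS](subnK lei) window_cat subnKC //; congr (_ ++ _).
by apply/eq_window => j _; rewrite add0n addnC omega_period.
Qed.

Lemma omega_window (x0 : T) x a p : 0 < p -> (forall i, x (i + p) = x i) ->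
  forall j, omega x0 (window x a p) j = x (a + j).
Proof.
move=> p0 per j; rewrite /omega size_window nth_window ?ltn_pmod //.
by rewrite [in RHS](divn_eq j p) addnCA [in RHS]addnC (periodM per).
Qed.

End Windows.

(** * Lyndon words and primitive roots *)

Section Lyndon.

Variables (T : eqType) (w : seq T).
Implicit Types (u l : seq T).

(* Words are compared by their value as numerals in base [(size w).+1], the
   digit of a letter being its first position in [w]; on words of equal length
   this is a lexicographic order. *)
Fixpoint code u : nat :=
  if u is c :: u' then index c w * (size w).+1 ^ size u' + code u' else 0.

Lemma code_cat u v : code (u ++ v) = code u * (size w).+1 ^ size v + code v.
Proof.
elim: u => [|c u IHu] //=; rewrite IHu size_cat expnD; nia.
Qed.

Lemma code_lt u : code u < (size w).+1 ^ size u.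
Proof.
elim: u => [|c u IHu] //=; rewrite expnS.
(* A letter outside [w] has index [size w], still a digit in base [(size w).+1]. *)
have := index_size c w; nia.
Qed.

Lemma code_inj u v : {subset u <= w} -> {subset v <= w} ->
  size u = size v -> code u = code v -> u = v.
Proof.
elim: u v => [|c u IHu] [|d v] //= cuw dvw [eqs] eqc.
have [ltu ltv] := (code_lt u, code_lt v).
rewrite eqs in eqc ltu.
have eqcd : index c w = index d w.
  have := congr1 (divn^~ ((size w).+1 ^ size v)) eqc.
  by rewrite /= !divnMDl ?expn_gt0 // !divn_small // !addn0.
congr (_ :: _).
  have cw : c \in w by apply: cuw; rewrite mem_head.
  have dw : d \in w by apply: dvw; rewrite mem_head.
  by rewrite -(nth_index c cw) eqcd nth_index.
apply: IHu => //.
- by move=> a au; apply: cuw; rewrite inE au orbT.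
- by move=> a av; apply: dvw; rewrite inE av orbT.
- by move: eqc; rewrite eqcd => /addnI.
Qed.

(** Strictness excludes proper powers, which equal one of their proper rotations. *)
Definition lyndon l :=
  (0 < size l) && all (fun i => code l < code (rot i l)) (iota 1 (size l).-1).

Lemma lyndonP l :
  reflect (0 < size l /\ forall i, 0 < i < size l -> code l < code (rot i l))
          (lyndon l).
Proof.
apply: (iffP andP) => -[l0 H]; split=> //.
  by move=> i lti; apply: (allP H); rewrite mem_iota; lia.
by apply/allP => i; rewrite mem_iota => lti; apply: H; lia.
Qed.

(** A border [b] gives [l = y b = b x] with [x], [y] of equal length. Minimality against [b y]
    yields [x < y], against [x b] it yields [y < x]. *)
Lemma lyndon_unbordered l d : lyndon l -> 0 < d < size l ->
  drop d l <> take (size l - d) l.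
Proof.
move=> /lyndonP[l0 lynl] ltd bord; set b := drop d l in bord.
have lt1 : code l < code (rot d l) by apply: lynl.
have lt2 : code l < code (rot (size l - d) l) by apply: lynl; lia.
set y := take d l; set x := drop (size l - d) l.
have sx : size x = d by rewrite size_drop; lia.
have sy : size y = d by rewrite size_takel //; lia.
have lyb : code l = code (y ++ b) by rewrite cat_take_drop.
have lbx : code l = code (b ++ x) by rewrite bord cat_take_drop.
move: lt1; rewrite lbx /rot -/b -/y !code_cat sx sy ltn_add2l => ltxy.
move: lt2; rewrite lyb /rot -bord -/x !code_cat ltn_add2r ltn_pmul2r ?expn_gt0 //.
by move=> ltyx; have := ltn_trans ltxy ltyx; rewrite ltnn.
Qed.

Lemma lyndon_rotN l i : lyndon l -> 0 < i < size l -> ~~ lyndon (rot i l).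
Proof.
move=> /lyndonP[_ lynl] lti; apply/negP => /lyndonP[_ lynr].
have lt1 := lynl _ lti.
have := lynr (size l - i); rewrite size_rot => lt2.
have {}lt2 : code (rot i l) < code (rot (size l - i) (rot i l)) by apply: lt2; lia.
have := rotK i l; rewrite /rotr size_rot => rotl; rewrite rotl in lt2.
by have := ltn_trans lt1 lt2; rewrite ltnn.
Qed.

Variable x0 : T.
Local Notation omega := (omega x0).

(** Equality would give [l'] the period [size l], hence a border. *)
Lemma lyndon_windowN l l' i n : lyndon l' -> 0 < size l < size l' ->
  size l' <= n -> window (omega l) i n <> window (omega l') 0 n.
Proof.
move=> lynl' lts len /eq_window eqw.
apply: (@lyndon_unbordered l' (size l)) => //.
apply: (@eq_from_nth _ x0) => [|j]; rewrite size_drop ?size_takel ?leq_subr //.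
move=> ltj; rewrite nth_drop nth_take //.
rewrite -(omega_nth x0 (i := j)); last by lia.
rewrite -(omega_nth x0 (u := l')); last by lia.
have := eqw j; rewrite add0n => <-; last by lia.
have := eqw (size l + j); rewrite add0n => <-; last by lia.
by rewrite addnCA addnC omega_period.
Qed.

(** The least rotation [p] fixing [u] is the length of its primitive root; the conjugate of that
    root with least code is Lyndon. *)
Lemma lyndon_root u : u != [::] -> {subset u <= w} ->
  exists l i m, [/\ lyndon l, i < size l, 0 < m &
                    u = window (omega l) i (m * size l)].
Proof.
move=> u_neq0 uw; set x := omega u.
have u0 : 0 < size u by rewrite lt0n size_eq0.
have xu i : x (i + size u) = x i by exact: omega_period.
have xw i n : {subset window x i n <= w}.
  move=> c /mapP[j _ ->]; apply: uw; apply: mem_nth; exact: ltn_pmod.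
have : exists p, [&& 0 < p, p <= size u & rot p u == u].
  by exists (size u); rewrite u0 leqnn rot_size eqxx.
move=> /ex_minnP[p /and3P[p0 lepu /eqP rotp] minp].
have xp i : x (i + p) = x i.
  rewrite -(period_mod _ xu) -modnDml (period_mod _ xu) addnC.
  have /eq_window -> : window x p (size u) = window x 0 (size u).
  - by rewrite -rot_window // rotp window_omega.
  - by rewrite add0n (period_mod _ xu).
  - exact: ltn_pmod.
have perN q : 0 < q < p -> ~ (forall i, x (i + q) = x i).
  move=> /andP[q0 ltqp] xq.
  have : p <= q; last by lia.
  apply: minp; rewrite q0 (ltnW (leq_trans ltqp lepu)) /=.
  rewrite (rot_window x0); last by lia.
  rewrite -[X in _ == X](window_omega x0); apply/eqP/eq_window => j _.
  by rewrite addnC -/x xq.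
have dvdp : p %| size u.
  apply/eqP; case: (posnP (size u %% p)) => // r0.
  case: (@perN (size u %% p)); first by rewrite r0 ltn_pmod.
  move=> i; rewrite -[in RHS]xu [in RHS](divn_eq (size u) p) addnCA [in RHS]addnC.
  by rewrite (periodM xp).
case: (@arg_minnP _ (Ordinal p0) xpredT (fun a : 'I_p => code (window x a p))) => //.
move=> a _ mina; set l := window x a p in mina.
have lE j : omega l j = x (a + j) by exact: omega_window.
have sl : size l = p by exact: size_window.
(* As [l] is read from position [a], reading from position 0 means starting [p - a] letters into
   [l], modulo [p] in case [a = 0]. *)
exists l, ((p - a) %% p), (size u %/ p); rewrite sl; split.
- apply/lyndonP; rewrite sl; split=> // i /andP[i0 ltip].
  have rotE : rot i l = window x (a + i) p.
    rewrite (rot_window x0) ?sl 1?ltnW //; apply/eq_window => j _.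
    by rewrite lE addnA.
  have rotE' : rot i l = window x ((a + i) %% p) p.
    rewrite rotE; apply/eq_window => j _.
    by rewrite -(period_mod _ xp) -modnDml (period_mod _ xp).
  have := mina (Ordinal (ltn_pmod (a + i) p0)) isT; rewrite /= -rotE' leq_eqVlt.
  case/predU1P => // eqc; case: (@perN i); first by rewrite i0.
  have : l = rot i l.
    apply: code_inj => //; rewrite ?size_rot // ?rotE'; exact: xw.
  rewrite rotE => /eq_window eqx j.
  (* [a + j'] is congruent to [j] and [j' < p], so [eqx] applies and makes [i] a period at every
     [j]. *)
  pose j' := (j + (p - a)) %% p.
  have xj t : x (a + t + j') = x (t + j).
    rewrite -(period_mod _ xp) /j' modnDmr (_ : _ + _ = t + j + p).
      by rewrite modnDr (period_mod _ xp).
    by have := ltn_ord a; lia.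
  by rewrite addnC -xj -(eqx j') ?ltn_pmod // -{1}[a : nat]addn0 xj add0n.
- exact: ltn_pmod.
- by rewrite divn_gt0.
- rewrite divnK // -[LHS](window_omega x0); apply/eq_window => j _.
  rewrite lE -/x -[RHS](period_mod _ xp) addnA -modnDml modnDmr.
  by rewrite subnKC ?modnn ?add0n ?(period_mod _ xp) // ltnW.
Qed.

(** * Rauzy graphs and their circuits *)

Definition factors_of_size n := [seq v <- factors w | size v == n].

Lemma mem_factors_of_size n v :
  (v \in factors_of_size n) = infix v w && (size v == n).
Proof. by rewrite mem_filter mem_factors andbC. Qed.

Lemma factors_of_size_uniq n : uniq (factors_of_size n).
Proof. exact/filter_uniq/factors_uniq. Qed.

(* The Rauzy graph of order [n] of [w] has the factors of length [n] as vertices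
   and those of length [n.+1] as edges; [circuits n] has one Lyndon word for each
   of its circuits of length at most [n]. *)
Definition circuits n :=
  [seq l <- factors w | [&& lyndon l, size l <= n &
     all (fun i => infix (window (omega l) i n.+1) w) (iota 0 (size l))]].

Lemma circuitsP n l :
  reflect [/\ lyndon l, size l <= n & forall i, infix (window (omega l) i n.+1) w]
          (l \in circuits n).
Proof.
rewrite mem_filter; apply: (iffP andP) => [[/and3P[lynl len /allP inw] _]|].
  have /lyndonP[l0 _] := lynl; split=> // i.
  have -> : window (omega l) i n.+1 = window (omega l) (i %% size l) n.+1.
    apply/eq_window => j _.
    have per := omega_period x0 l.
    by rewrite -[LHS](period_mod _ per) -modnDml (period_mod _ per).
  by apply: inw; rewrite mem_iota ltn_mod.
move=> [lynl len inw]; split.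
  by rewrite lynl len; apply/allP => i _.
rewrite mem_factors -{1}(window_omega x0 l).
by apply: infix_trans (inw 0); apply: infix_window => //; rewrite leqW.
Qed.

Lemma circuits_uniq n : uniq (circuits n).
Proof. exact/filter_uniq/factors_uniq. Qed.

Definition closing_edge n l := window (omega l) 0 n.+1.

(** Different lengths are excluded by unborderedness; for equal lengths the word is a prefix of its
    edge. *)
Lemma closing_edge_inj n : {in circuits n &, injective (closing_edge n)}.
Proof.
have lt_neq l l' : l \in circuits n -> l' \in circuits n ->
    size l < size l' -> closing_edge n l <> closing_edge n l'.
  move=> /circuitsP[/lyndonP[l0 _] _ _] /circuitsP[lynl' len' _] lts.
  move=> /eq_window eqw; apply: (@lyndon_windowN l l' 0 n) => //.
    by rewrite l0.
  by apply/eq_window => j ltj; apply: eqw; rewrite leqW.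
move=> l l' lC l'C eqe.
have [/lt_neq|/lt_neq|eqs] := ltngtP (size l) (size l').
- by move/(_ lC l'C).
- by move/(_ l'C lC); rewrite eqe.
have /circuitsP[_ len _] := lC.
rewrite -(window_omega x0 l) -(window_omega x0 l') -eqs.
rewrite -(take_window _ _ (leqW len)) -[RHS](take_window _ _ (leqW len)).
by rewrite -/(closing_edge n l) eqe.
Qed.

(* Deleting the closing edges keeps the Rauzy graph connected: the other edges
   of the circuit of [l] are either kept or closing edges of shorter circuits. *)
Lemma circuits_bound n : n < size w ->
  size (circuits n) + size (factors_of_size n) <= (size (factors_of_size n.+1)).+1.
Proof.
move=> ltnw; set V := factors_of_size n; set E := factors_of_size n.+1.
pose S := [seq closing_edge n l | l <- circuits n].
have uS : uniq S.
  by rewrite map_inj_in_uniq ?circuits_uniq //; apply: closing_edge_inj.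
have inE i l : l \in circuits n -> window (omega l) i n.+1 \in E.
  by move=> /circuitsP[_ _ inw]; rewrite mem_factors_of_size inw size_window eqxx.
have leSE : size S <= count (fun e => e \in S) E.
  rewrite -size_filter; apply: uniq_leq_size => // e eS.
  by rewrite mem_filter /= eS; have /mapP[l lC ->] := eS; apply: inE.
have sE : count (fun e => e \in S) E + count (fun e => e \notin S) E = size E.
  exact: count_predC.
suff : size V <= (size [seq e <- E | e \notin S]).+1.
  have sS : size S = size (circuits n) by rewrite size_map.
  by rewrite size_filter; lia.
apply: (leq_vertices_edges (src := take n) (tgt := behead) (r := take n w)).
  exact: factors_of_size_uniq.
move=> h h0 kept.
have step x i : window x i n.+1 \in E -> window x i n.+1 \notin S ->
    h (window x i n) = h (window x i.+1 n).
  move=> eE eS; rewrite -[window x i n](take_window _ _ (leqnSn n)).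
  by rewrite kept // mem_filter eS.
have closing q : forall l, size l = q -> l \in circuits n ->
    h (window (omega l) 0 n) = h (window (omega l) 1 n).
  elim/ltn_ind: q => q IHq l sl lC; have /circuitsP[lynl len _] := lC.
  have /lyndonP[l0 _] := lynl.
  have around i : 0 < i <= size l ->
      h (window (omega l) 1 n) = h (window (omega l) i n).
    elim: i => // -[|i] // IHi lti; rewrite IHi; last by lia.
    have [eS|/step->//] := boolP (window (omega l) i.+1 n.+1 \in S); last exact: inE.
    have /mapP[l' l'C eqe] := eS; have /circuitsP[lynl' len' _] := l'C.
    have /lyndonP[l'0 _] := lynl'.
    have eqw m : m <= n.+1 -> window (omega l) i.+1 m = window (omega l') 0 m.
      by move=> lem; rewrite -(take_window _ _ lem) eqe take_window.
    have -> : window (omega l) i.+2 n = window (omega l') 1 n.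
      by have := congr1 behead eqe.
    rewrite eqw //; apply: (IHq (size l')) => //.
    (* For equal lengths [l'] would be a proper rotation of [l]; a longer [l'] would have a
       border. *)
    rewrite -sl ltnNge leq_eqVlt; apply/negP => /predU1P[eqs|lts].
      have /negP[] := @lyndon_rotN l i.+1 lynl lti.
      by rewrite (rot_window x0) 1?ltnW // eqw ?leqW // eqs window_omega.
    by apply: (@lyndon_windowN l l' i.+1 n); rewrite ?l0 ?eqw.
  rewrite (around (size l)) ?l0 ?leqnn //; congr h.
  by apply/eq_window => j _; rewrite add0n addnC omega_period.
have edges e : e \in E -> h (take n e) = h (behead e).
  move=> eE; have [/mapP[l lC ->]|eS] := boolP (e \in S).
    by rewrite take_window //; apply: closing lC.
  by rewrite kept // mem_filter eS.
(* Sliding along [w] from its prefix of length [n] visits every vertex. *)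
have along i : i + n <= size w -> h (take n (drop i w)) = false.
  elim: i => [|i IHi] lti; first by rewrite drop0.
  rewrite -[RHS]IHi; last by lia.
  have lti' : i < size w by lia.
  have dropE := drop_nth x0 lti'.
  have := edges (take n.+1 (drop i w)); rewrite take_takel // => -> //.
    by rewrite dropE.
  rewrite mem_factors_of_size size_takel ?size_drop ?eqxx ?andbT; last by lia.
  apply/infixP; exists (take i w), (drop n.+1 (drop i w)).
  by rewrite !cat_take_drop.
move=> v; rewrite mem_factors_of_size => /andP[/infixP[s1 [s2 ew]] /eqP sv].
have := along (size s1); rewrite ew drop_size_cat // -sv take_size_cat //; apply.
by rewrite !size_cat; lia.
Qed.

(** * Summation over orders, and charging powers to circuits *)

Lemma sum_circuits :
  \sum_(1 <= n < size w) size (circuits n) + size (Alph w) <= size w.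
Proof.
have [/size0nil->|w0] := posnP (size w); first by rewrite big_geq.
have leAlph : size (Alph w) <= size (factors_of_size 1).
  rewrite -(size_map (fun c => [:: c])); apply: uniq_leq_size.
    by rewrite map_inj_uniq ?undup_uniq // => c d [].
  move=> v /mapP[c]; rewrite mem_undup => cw ->.
  rewrite mem_factors_of_size eqxx andbT.
  by have /path.splitPr[s1 s2] := cw; apply/infixP; exists s1, s2.
have le1 : size (factors_of_size (size w)) <= 1.
  apply: (@uniq_leq_size _ _ [:: w]) => [|v]; first exact: factors_of_size_uniq.
  rewrite mem_factors_of_size inE => /andP[/infixP[s1 [s2 ew]] /eqP sv].
  move: (congr1 size ew); rewrite !size_cat sv => es.
  have /size0nil e1 : size s1 = 0 by lia.
  have /size0nil e2 : size s2 = 0 by lia.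
  by rewrite ew e1 e2 cats0.
(* Telescoping [circuits_bound] adds one unit per order, [size w - 1] in all; the last unit is the
   factor [w] itself. *)
suff : forall m, m < size w -> \sum_(1 <= n < m.+1) size (circuits n) +
    size (factors_of_size 1) <= size (factors_of_size m.+1) + m.
  by case: (size w) w0 le1 => // m _ le1 /(_ m (leqnn _)); lia.
elim=> [|m IHm] ltm; first by rewrite big_geq // addn0.
rewrite big_nat_recr //=; have := circuits_bound ltm; have := IHm (ltnW ltm); lia.
Qed.

Lemma num_powers_circuits k : 2 < k ->
  num_powers k w * (k - 2) <= \sum_(1 <= n < size w) size (circuits n).
Proof.
move=> hk; pose P := [seq v <- factors w | (v != [::]) && is_power k v].
pose D := [seq (n, l) | n <- index_iota 1 (size w), l <- circuits n].
have -> : \sum_(1 <= n < size w) size (circuits n) = size D.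
  by rewrite size_allpairs_dep sumnE big_map.
(* [g] decodes: it suffices that its image contains every pair [(v, j)]. *)
pose g (nl : nat * seq T) := let: (n, l) := nl in
  let p := size l in let y := (n - p) %/ (k - 2) in
  (window (omega l) (y %% p) (k * ((y %/ p).+1 * p)), (n - p) %% (k - 2)).
have -> : num_powers k w * (k - 2) = size [seq (v, j) | v <- P, j <- iota 0 (k - 2)].
  by rewrite size_allpairs size_iota.
rewrite -(size_map g); apply: uniq_leq_size.
  apply: allpairs_uniq; rewrite ?iota_uniq //.
    exact/filter_uniq/factors_uniq.
  by move=> [? ?] [? ?].
move=> _ /allpairsP[[v j] /= [vP jk ->]].
move: vP; rewrite mem_filter mem_factors => /andP[/andP[v0 /is_powerP[u vE]] vw].
rewrite mem_iota add0n /= in jk.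
have u0 : u != [::].
  by apply: contraNneq v0 => u0; rewrite vE u0; elim: (k).
have uw : {subset u <= w}.
  move=> c cu; apply: (mem_infix vw); rewrite vE; case: (k) hk => // k' _.
  by rewrite /word_pow /= mem_cat cu.
have [l [i [m [lynl lti m0 uE]]]] := lyndon_root u0 uw.
have /lyndonP[p0 _] := lynl.
have vE' : v = window (omega l) i (k * (m * size l)).
  rewrite vE uE -window_pow // => t; rewrite periodM // => s.
  exact: omega_period.
have sv : size v = k * (m * size l) by rewrite vE' size_window.
set p := size l in lti p0 vE' sv.
(* The circuit encoding [(v, j)] has order [p + y (k - 2) + j], from which [g]
   recovers [j], [i] and [m] by Euclidean division. *)
pose y := m.-1 * p + i; pose n := p + (y * (k - 2) + j).
have lew : size v <= size w by exact: size_infix.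
(* From [y.+1 <= m * p] and [j < k - 2], [n + p < 2 * p + m * p * (k - 2) <= k * (m * p)]. *)
have len : n + p <= size v.
  rewrite sv /n /y -(subnK (ltnW hk)) addnK; set k' := k - 2 in jk *.
  rewrite -(prednK m0) /=; set m' := m.-1.
  have : i.+1 * k' <= p * k' by rewrite leq_mul2r lti orbT.
  have := leq0n (m' * p); lia.
have lepn : p <= n := leq_addr _ _.
apply/mapP; exists (n, l).
  apply/allpairsPdep; exists n, l; split=> //.
    by rewrite mem_index_iota; move: n lepn len => n' *; lia.
  apply/circuitsP; split=> // t; apply: infix_trans vw; rewrite vE' -sv.
  (* By periodicity the window can be moved inside the occurrence of [v]. *)
  pose t' := i + (t + (p - i)) %% p.
  have -> : window (omega l) t n.+1 = window (omega l) t' n.+1.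
    apply/eq_window => s _; rewrite /omega -/p; congr nth.
    rewrite /t' addnAC modnDmr.
    have -> : i + s + (t + (p - i)) = t + s + p by lia.
    by rewrite modnDr.
  have letp : t' < i + p by rewrite ltn_add2l ltn_pmod.
  have leit : i <= t' := leq_addr _ _.
  by apply: infix_window => //; move: n t' sv len letp {leit lepn} => n' t' *; lia.
have k2 : 0 < k - 2 by lia.
rewrite /g -/p /n addKn divnMDl // (divn_small jk) addn0 modnMDl (modn_small jk).
rewrite /y modnMDl (modn_small lti) divnMDl // (divn_small lti) addn0 prednK //.
by rewrite vE'.
Qed.

End Lyndon.

Import Order.TTheory GRing.Theory Num.Theory.
Local Open Scope ring_scope.

Theorem theorem1p1 (T : eqType) (k : nat) (hk : (2 < k)%N) (w : seq T) :
  (num_powers k w)%:R <=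
    ((size w)%:R - (size (Alph w))%:R) / (k%:R - 2%:R) :> rat.
Proof.
(* A non-empty word supplies the default letter [x0]. *)
case: w => [|x0 w'].
  by rewrite /num_powers /= subrr mul0r.
set w := x0 :: w'.
have := num_powers_circuits w x0 hk; have := sum_circuits w x0 => le1 le2.
have k2 : 0 < k%:R - 2%:R :> rat by rewrite subr_gt0 ltr_nat.
rewrite ler_pdivlMr // -natrB 1?ltnW // -natrM lerBrDr -natrD ler_nat.
by apply: leq_trans le1; rewrite leq_add2r.
Qed.
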